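(* Approval Voting (AV) does not satisfy simple justified representation for any integers $k\ge 2$ and $d\ge 2$, nor for any integers $k\ge 3$ and $d\ge 1$.
   Context: Attribute-approval instance: a finite nonempty set of voters $V=\{v_1,\dots,v_n\}$, a finite set of candidates $C=\{c_1,\dots,c_m\}$, a number of dimensions $d\ge 1$, and a target committee size $1\le k\le m$. Each candidate $c$ has a vector of attribute values $(c[1],\dots,c[d])$ with $c[j]\in D^j$, where $D^j$ is a finite domain; every value in $D^j$ is the value $c[j]$ of at least one candidate $c\in C$ (different candidates may share values). Each voter $v_i$ submits, for every $j\in\{1,\dots,d\}$, a set $C_i^j\subseteq D^j$ of approved values. A committee is a subset $W\subseteq C$ with $|W|=k$, and $W^j=\{c[j]: c\in W\}$. AV selects a committee $W$ of size $k$ maximizing $\sum_{v_i\in V}\sum_{c\in W}\frac{|\{j: c[j]\in C_i^j\}|}{d}$. Simple justified representation (SJR) of $W$: for every $V'\subseteq V$ with $|V'|\ge \frac nk$ such that $\bigcap_{v_i\in V'}C_i^j\neq\emptyset$ for some $j\in\{1,\dots,d\}$, there is $j'\in\{1,\dots,d\}$ with $\left(\bigcup_{v_i\in V'}C_i^{j'}\right)\cap W^{j'}\ne\emptyset$. Convention for ties: a rule does not satisfy a property for given $(k,d)$ if there is an instance with these parameters on which no committee the rule may output (over all ways of resolving ties) has the property. *)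

(* Defs.v *)
From mathcomp Require Import all_boot all_order all_algebra.

Set Implicit Arguments.
Unset Strict Implicit.
Unset Printing Implicit Defensive.

Import GRing.Theory Num.Theory.
Local Open Scope ring_scope.

(* Attribute-approval instances with committee size k and d dimensions.
   The dimensions are indexed by 'I_d, i.e. from 0 to d - 1. *)
Record instance (k d : nat) := Instance {
  voter : finType;
  cand : finType;
  dom : 'I_d -> finType;
  attr : forall j : 'I_d, cand -> dom j;
  approved : voter -> forall j : 'I_d, {set dom j};
  voter_gt0 : (0 < #|voter|)%N;
  dim_gt0 : (0 < d)%N;
  size_gt0 : (0 < k)%N;
  size_le_cand : (k <= #|cand|)%N;
  attr_surj : forall (j : 'I_d) (x : dom j), exists c : cand, attr j c = x
}.

Arguments voter {k d} _.
Arguments cand {k d} _.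
Arguments dom {k d} _ _.
Arguments attr {k d} _ _ _.
Arguments approved {k d} _ _ _.

Definition committee k d (I : instance k d) (W : {set cand I}) : Prop :=
  #|W| = k.

(* W^j *)
Definition values k d (I : instance k d) (W : {set cand I}) (j : 'I_d) :
    {set dom I j} :=
  [set attr I j c | c in W].

Definition av_score k d (I : instance k d) (W : {set cand I}) : rat :=
  \sum_(v : voter I) \sum_(c in W)
    #|[set j : 'I_d | attr I j c \in approved I v j]|%:R / d%:R.

(* A rule is given by its set of possible outputs, over all ways of
   resolving ties. *)
Definition rule := forall k d (I : instance k d), {set cand I} -> Prop.

Definition property := forall k d (I : instance k d), {set cand I} -> Prop.

Definition AV : rule := fun k d (I : instance k d) W =>
  committee W /\
  forall W' : {set cand I}, committee W' -> av_score W' <= av_score W.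

Definition SJR : property := fun k d (I : instance k d) W =>
  forall V' : {set voter I},
    #|voter I|%:R / k%:R <= #|V'|%:R :> rat ->
    (exists j : 'I_d, \bigcap_(v in V') approved I v j != set0) ->
    exists j' : 'I_d,
      (\bigcup_(v in V') approved I v j') :&: values W j' != set0.

Definition does_not_satisfy (R : rule) (P : property) (k d : nat) : Prop :=
  exists I : instance k d, forall W : {set cand I}, R k d I W -> ~ P k d I W.

(* Main.v *)
(** There are [k] voters and [k + 1] candidates, [k] of which ("majority"
    candidates) have the value [true] in every dimension, while the last one has
    the value [false] in every dimension. One voter approves [false], in the
    first dimension only; the other [k - 1] voters approve exactly [true] in
    every dimension. A majority candidate scores [k - 1] and the last candidate
    [1 / d], so as soon as [1 < (k - 1) * d] AV selects exactly the majority
    candidates. The dissenting voter alone makes up a group of size [n / k] and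
    none of its approved values is represented. *)
Require Import Defs.
From mathcomp Require Import all_boot all_order all_algebra.

Set Implicit Arguments.
Unset Strict Implicit.
Unset Printing Implicit Defensive.

Import Order.TTheory GRing.Theory Num.Theory.

Section Dissenter.

Variables k d : nat.

(* The committee size is [k.+1] and the number of dimensions is [d.+1]; the
   candidate [None] is the one supported by the dissenting voter [ord0]. *)
Definition dissenter_attr (j : 'I_d.+1) (c : option 'I_k.+1) : bool := isSome c.

(** With [false] approved in every dimension, [None] would score 1 and tie with the others when
    [k = 1]. *)
Definition dissenter_approved (v : 'I_k.+1) (j : 'I_d.+1) : {set bool} :=
  if v == ord0 then [set b | (j == ord0) && ~~ b] else [set true].

Lemma dissenter_voter_gt0 : 0 < #|'I_k.+1|.
Proof. by rewrite card_ord. Qed.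

Lemma dissenter_size_le_cand : k.+1 <= #|{: option 'I_k.+1}|.
Proof. by rewrite card_option card_ord. Qed.

Lemma dissenter_attr_surj (j : 'I_d.+1) (b : bool) :
  exists c, dissenter_attr j c = b.
Proof. by case: b; [exists (Some ord0) | exists None]. Qed.

Definition dissenter_instance : instance k.+1 d.+1 :=
  @Instance k.+1 d.+1 'I_k.+1 (option 'I_k.+1) (fun=> bool) dissenter_attr
    dissenter_approved dissenter_voter_gt0 (ltn0Sn d) (ltn0Sn k)
    dissenter_size_le_cand dissenter_attr_surj.

Local Open Scope ring_scope.

Lemma card_dissenter_approved (v : 'I_k.+1) (c : option 'I_k.+1) :
  #|[set j | dissenter_attr j c \in dissenter_approved v j]| =
  (if v == ord0 then ~~ isSome c : nat else isSome c * d.+1)%N.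
Proof.
rewrite /dissenter_attr /dissenter_approved.
case: (v == ord0); case: c => [i|] /=.
- by apply: eq_card0 => j; rewrite !inE andbF.
- rewrite -(cards1 (ord0 : 'I_d.+1)); congr #|pred_of_set _|.
  by apply/setP => j; rewrite !inE andbT.
- by rewrite mul1n -[RHS]card_ord; apply: eq_card => j; rewrite !inE.
- by rewrite mul0n; apply: eq_card0 => j; rewrite !inE.
Qed.

Lemma dissenter_av_score (W : {set cand dissenter_instance}) :
  av_score W = \sum_(c in W) (if c is Some _ then k%:R else d.+1%:R^-1).
Proof.
rewrite /av_score exchange_big; apply: eq_bigr => c _ /=.
rewrite (bigD1 ord0) //= card_dissenter_approved eqxx.
under eq_bigr => v /negPf v_neq0 do rewrite card_dissenter_approved v_neq0.
rewrite sumr_const cardC1 card_ord /=.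
case: c => [i|] /=; last by rewrite !mul0r mul0rn addr0 mul1r.
by rewrite mul0r add0r mul1n divff ?pnatr_eq0.
Qed.

Lemma dissenter_av_score_majority (W : {set cand dissenter_instance}) :
  None \notin W -> av_score W = k%:R *+ #|W|.
Proof.
move=> NW; rewrite dissenter_av_score (eq_bigr (fun=> k%:R)) ?sumr_const //.
by case=> [i|] // /idPn[].
Qed.

Lemma dissenter_committee (W : {set cand dissenter_instance}) :
  (1 < k * d.+1)%N -> AV W -> None \notin W.
Proof.
move=> kd_gt1 [cardW maxW]; apply/negP => NW.
pose M : {set cand dissenter_instance} := [set~ None].
have cardM : #|M| = k.+1 by rewrite cardsC1 card_option card_ord.
have := maxW M cardM; apply/negP; rewrite -ltNge.
have cardWN : #|W :\ None| = k.
  by have := cardsD1 None W; rewrite NW cardW add1n => -[<-].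
rewrite (dissenter_av_score_majority (W := M)) ?setC11 // cardM.
(* The [k] majority members of [W] cancel against [k] of those in [M], leaving [1 / d.+1 < k]. *)
rewrite dissenter_av_score (big_setD1 None NW) /= -dissenter_av_score.
rewrite dissenter_av_score_majority ?setD11 // cardWN (mulrS k%:R) ltrD2r.
by rewrite -div1r ltr_pdivrMr ?ltr0n // -natrM ltr1n.
Qed.

Lemma dissenter_not_SJR (W : {set cand dissenter_instance}) :
  None \notin W -> ~ SJR W.
Proof.
(* Voters and seats both number [k.+1], so the group-size threshold is exactly 1. *)
move=> NW /(_ [set ord0]); rewrite cards1 /= card_ord divff ?pnatr_eq0 //.
case=> // [|j].
  exists ord0; rewrite big_set1 /dissenter_approved eqxx.
  by apply/set0Pn; exists false; rewrite !inE.
rewrite big_set1 /dissenter_approved eqxx => /set0Pn[b].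
rewrite !inE => /andP[/andP[_ bF] /imsetP[c cW bE]].
by case: c cW bE => [i _|] => [bE|]; [rewrite bE in bF | rewrite (negPf NW)].
Qed.

Lemma AV_not_SJR : (1 < k * d.+1)%N -> does_not_satisfy AV SJR k.+1 d.+1.
Proof.
move=> kd_gt1; exists dissenter_instance => W AVW.
exact: dissenter_not_SJR (dissenter_committee kd_gt1 AVW).
Qed.

End Dissenter.

Theorem lemma3 :
  (forall k d : nat, 2 <= k -> 2 <= d -> does_not_satisfy AV SJR k d) /\
  (forall k d : nat, 3 <= k -> 1 <= d -> does_not_satisfy AV SJR k d).
Proof.
split=> -[|k] // [|d] // k_gt d_gt; apply: AV_not_SJR.
  (* One factor of [k * d.+1] is at least 2, the other positive. *)
  by apply: leq_trans d_gt _; apply: leq_pmull.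
by rewrite ltnS in k_gt; apply: leq_trans k_gt _; apply: leq_pmulr.
Qed.
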